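(* A ring $R$ is right noetherian if and only if all of its completely prime right ideals are finitely generated (as right ideals).
   Context: Rings are associative with $1$, not necessarily commutative. A right ideal $P\subsetneq R$ is completely prime if for all $a,b\in R$ with $aP\subseteq P$, $ab\in P$ implies $a\in P$ or $b\in P$. *)

(* Defs.v *)
From HB Require Import structures.
From mathcomp Require Import all_boot all_order all_algebra.
From mathcomp Require Import boolp classical_sets functions cardinality.
Set Implicit Arguments.
Unset Strict Implicit.
Unset Printing Implicit Defensive.
Import GRing.Theory.
Local Open Scope classical_set_scope.
Local Open Scope ring_scope.

(* [pzRingType]: associative rings with 1, not necessarily commutative, the
   zero ring being allowed. MathComp's own ideals (ring_quotient) are boolean,
   proper, and closed under multiplication on the left, hence the definitions
   below on arbitrary subsets [set R]. *)

Record right_ideal (R : pzRingType) (I : set R) : Prop := RightIdeal {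
  right_ideal0 : I 0 ;
  right_idealB : forall x y, I x -> I y -> I (x - y) ;
  right_idealMr : forall x r, I x -> I (x * r)
}.

Definition fg_right_ideal (R : pzRingType) (I : set R) : Prop :=
  exists2 A : set R, finite_set A & I = smallest (@right_ideal R) A.

Record completely_prime (R : pzRingType) (P : set R) : Prop := CompletelyPrime {
  completely_prime_ideal : right_ideal P ;
  completely_prime_proper : P `<` [set: R] ;
  completely_primeP : forall a b : R,
    [set a * x | x in P] `<=` P -> P (a * b) -> P a \/ P b
}.

Definition right_noetherian (R : pzRingType) : Prop :=
  forall I : nat -> set R,
    (forall n, right_ideal (I n)) ->
    (forall n, I n `<=` I n.+1) ->
    exists N, forall n, (N <= n)%N -> I n = I N.

(* Main.v *)
Require Import Defs.
From HB Require Import structures.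
From mathcomp Require Import all_boot all_order all_algebra.
From mathcomp Require Import boolp classical_sets functions cardinality.
Set Implicit Arguments.
Unset Strict Implicit.
Unset Printing Implicit Defensive.

(** A right ideal that is maximal among those that are not finitely generated
    is completely prime: this is the noncommutative version of Cohen's
    argument.  Let [P] be such a right ideal, and suppose that [aP] is
    contained in [P] and that [ab] lies in [P], but neither [a] nor [b] does.
    Then [P + aR] is strictly larger than [P], hence finitely generated.  So is
    [(P : a) = {x | ax \in P}]: it contains [P] because [aP] is contained in
    [P], and it contains [b].  But [P] is finitely generated as soon as both
    [P + aR] and [(P : a)] are ([fg_from_adjoin_colon]), a contradiction.

    A nonempty chain of right ideals whose union is finitely generated has that
    union as a member: finitely many generators already lie in one member
    ([chain_fg_bigcup]).  Hence a union of a nonempty chain of right ideals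
    that are not finitely generated is not finitely generated either, and
    Zorn's lemma extends any right ideal that is not finitely generated to a
    maximal one ([exists_maximal_non_fg]).  So if all completely prime right
    ideals are finitely generated, then all right ideals are.

    What remains is the classical equivalence between the ascending chain
    condition and the finite generation of all right ideals
    ([right_noetherian_fg], [fg_right_noetherian]); one half of it uses
    [chain_fg_bigcup] again. *)

Import GRing.Theory.
Local Open Scope classical_set_scope.
Local Open Scope ring_scope.

(** * Spans and finite generation *)

Notation right_span := (smallest (@right_ideal _)).

Lemma right_idealD (R : pzRingType) (I : set R) (x y : R) :
  right_ideal I -> I x -> I y -> I (x + y).
Proof.
move=> rI Ix Iy; rewrite -[y]opprK -[- y]sub0r.
by apply: (right_idealB rI Ix); apply: (right_idealB rI) => //;
  apply: right_ideal0.
Qed.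

Lemma right_ideal_right_span (R : pzRingType) (A : set R) :
  right_ideal (right_span A).
Proof.
split=> [M [rM _]|x y Ax Ay M MA|x r Ax M MA]; first exact: right_ideal0.
  by case: (MA) => rM _; apply: (right_idealB rM); [exact: Ax|exact: Ay].
by case: (MA) => rM _; apply: (right_idealMr rM r); exact: Ax.
Qed.

Lemma fg_of_subset_span (R : pzRingType) (I A : set R) :
  right_ideal I -> finite_set A -> A `<=` I -> I `<=` right_span A ->
  fg_right_ideal I.
Proof.
move=> rI finA AI IA; exists A => //; apply/seteqP; split => //.
exact: smallest_sub.
Qed.

Lemma fg_setT (R : pzRingType) : fg_right_ideal [set: R].
Proof.
apply: (@fg_of_subset_span R _ [set 1]) => //.
move=> x _; rewrite -[x]mul1r.
apply: (right_idealMr (right_ideal_right_span _)).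
exact: sub_gen_smallest.
Qed.

(** * Sums with a principal right ideal, and transporters *)

Definition adjoin (R : pzRingType) (I : set R) (a : R) : set R :=
  [set x | exists2 y, I y & exists r, x = y + a * r].

Definition colon (R : pzRingType) (I : set R) (a : R) : set R :=
  [set x | I (a * x)].

Lemma right_ideal_adjoin (R : pzRingType) (I : set R) (a : R) :
  right_ideal I -> right_ideal (adjoin I a).
Proof.
move=> rI; split.
- by exists 0; [exact: right_ideal0|exists 0; rewrite mulr0 addr0].
- move=> _ _ [y Iy [r ->]] [z Iz [s ->]].
  exists (y - z); first exact: right_idealB.
  by exists (r - s); rewrite mulrBr opprD addrACA.
- move=> _ t [y Iy [r ->]]; exists (y * t); first exact: right_idealMr.
  by exists (r * t); rewrite mulrDl mulrA.
Qed.

Lemma sub_adjoin (R : pzRingType) (I : set R) (a : R) : I `<=` adjoin I a.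
Proof. by move=> x Ix; exists x => //; exists 0; rewrite mulr0 addr0. Qed.

Lemma mem_adjoin (R : pzRingType) (I : set R) (a : R) :
  right_ideal I -> adjoin I a a.
Proof.
move=> rI; exists 0; first exact: right_ideal0.
by exists 1; rewrite mulr1 add0r.
Qed.

Lemma right_ideal_colon (R : pzRingType) (I : set R) (a : R) :
  right_ideal I -> right_ideal (colon I a).
Proof.
move=> rI; split; rewrite /colon /=.
- by rewrite mulr0; exact: right_ideal0.
- by move=> x y Ix Iy; rewrite mulrBr; exact: right_idealB.
- by move=> x r Ix; rewrite mulrA; exact: right_idealMr.
Qed.

(** Each generator of [I + aR] splits as [y + ar] with [y] in [I]; let [B] be
    the finite set of these [y].  Then [I] lies in [BR + aR], and an element
    [y + as] of [I] with [y] in [BR] has [s] in [(I : a)].  So [I] is generated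
    by [B] together with [aD], for any set [D] that generates [(I : a)]. *)
Lemma fg_from_adjoin_colon (R : pzRingType) (I : set R) (a : R) :
  right_ideal I -> fg_right_ideal (adjoin I a) ->
  fg_right_ideal (colon I a) -> fg_right_ideal I.
Proof.
move=> rI [A finA defA] [D finD defD].
(* The value [0] off [I + aR] makes the choice of components total. *)
have /choice[p pP] (x : R) : exists y,
    I y /\ (adjoin I a x -> exists r, x = y + a * r).
  have [[y Iy yr]|nx] := pselect (adjoin I a x); first by exists y.
  by exists 0; split=> //; exact: right_ideal0.
set B := [set p x | x in A]; set aD := [set a * x | x in D].
have BI : B `<=` I by move=> _ [x _ <-]; case: (pP x).
have aDI : aD `<=` I.
  move=> _ [x Dx <-]; rewrite -[I _]/(colon I a x) defD.
  exact: sub_gen_smallest.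
apply: (@fg_of_subset_span _ _ (B `|` aD)) => //.
- by rewrite finite_setU; split; exact: finite_image.
- by rewrite subUset.
have rS := right_ideal_right_span (B `|` aD).
have adjoinE : adjoin I a `<=` adjoin (right_span B) a.
  rewrite {1}defA; apply: smallest_sub.
    exact/right_ideal_adjoin/right_ideal_right_span.
  move=> x Ax; have adx : adjoin I a x by rewrite defA; exact: sub_gen_smallest.
  have [_ /(_ adx) [r xE]] := pP x.
  by exists (p x); [apply: sub_gen_smallest; exists x|exists r].
have colonE : colon I a `<=` colon (right_span (B `|` aD)) a.
  rewrite defD; apply: smallest_sub; first exact: right_ideal_colon.
  by move=> x Dx; apply: sub_gen_smallest; right; exists x.
move=> x Ix; have [y By [s xE]] := adjoinE _ (@sub_adjoin _ _ a _ Ix).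
have Iy : I y by apply: (smallest_sub rI BI).
have Ias : colon I a s.
  by rewrite /colon /= -[a * s](addKr y) addrC -xE; exact: right_idealB.
rewrite xE; apply: (right_idealD rS); last exact: colonE.
exact: (sub_smallest2r rS (@subsetUl _ B aD)).
Qed.

(** * Chains of right ideals *)

Lemma finite_sub_chain_bigcup (T : eqType) (G : set (set T)) (A : set T) :
  G !=set0 -> total_on G subset -> finite_set A -> A `<=` \bigcup_(X in G) X ->
  exists2 X, G X & A `<=` X.
Proof.
move=> [X0 GX0] totG /finite_seqP[s ->{A}].
elim: s => [|x s IHs] sG; first by exists X0.
have [|X GX sX] := IHs; first by move=> y ys; apply: sG; rewrite /= inE ys orbT.
have [|Y GY Yx] := sG x; first by rewrite /= inE eqxx.
have [XY|YX] := totG _ _ GX GY; [exists Y|exists X] => // y /=.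
  by rewrite inE => /orP[/eqP->//|/sX/XY].
by rewrite inE => /orP[/eqP->|/sX//]; exact: YX.
Qed.

Lemma right_ideal_chain_bigcup (R : pzRingType) (G : set (set R)) :
  G !=set0 -> total_on G subset -> G `<=` @right_ideal R ->
  right_ideal (\bigcup_(X in G) X).
Proof.
move=> [X0 GX0] totG rG; split.
- by exists X0 => //; apply: right_ideal0; exact: rG.
- move=> x y [X GX Xx] [Y GY Yy]; have [XY|YX] := totG _ _ GX GY.
    by exists Y => //; apply: (right_idealB (rG _ GY)) => //; exact: XY.
  by exists X => //; apply: (right_idealB (rG _ GX)) => //; exact: YX.
- by move=> x r [X GX Xx]; exists X => //; apply: (right_idealMr (rG _ GX) r).
Qed.

(** Some member [X] of the chain contains a finite set of generators of the
    union, and a right ideal that contains these generators contains the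
    union. *)
Lemma chain_fg_bigcup (R : pzRingType) (G : set (set R)) :
  G !=set0 -> total_on G subset -> G `<=` @right_ideal R ->
  fg_right_ideal (\bigcup_(X in G) X) -> G (\bigcup_(X in G) X).
Proof.
move=> G0 totG rG [A finA defA].
have AG : A `<=` \bigcup_(X in G) X by rewrite defA; exact: sub_gen_smallest.
have [X GX AX] := finite_sub_chain_bigcup G0 totG finA AG.
suff <- : X = \bigcup_(X in G) X by [].
apply/seteqP; split; first by move=> x Xx; exists X.
by rewrite defA; apply: smallest_sub => //; exact: rG.
Qed.

Lemma exists_maximal_non_fg (R : pzRingType) (I : set R) :
  right_ideal I -> ~ fg_right_ideal I ->
  exists P : set R, [/\ right_ideal P, ~ fg_right_ideal P &
    forall J, right_ideal J -> P `<` J -> fg_right_ideal J].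
Proof.
move=> rI nfgI.
(* Zorn's lemma is used here on a family that must contain the union of the
   empty chain; adding [I] to every set turns that union into [I]. *)
pose bad X := right_ideal (I `|` X) /\ ~ fg_right_ideal (I `|` X).
have [F Fbad totF|A [[rA nfgA] maxA]] := @Zorn_bigcup R bad.
  pose G := [set I] `|` [set I `|` X | X in F].
  have GE : I `|` \bigcup_(X in F) X = \bigcup_(X in G) X.
    apply/seteqP; split.
      move=> x [Ix|[X FX Xx]]; first by exists I => //; left.
      by exists (I `|` X); [right; exists X|right].
    move=> x [_ [->|[X FX <-]]]; first by left.
    by case=> [Ix|Xx]; [left|right; exists X].
  have G0 : G !=set0 by exists I; left.
  have totG : total_on G subset.
    move=> _ _ [->|[X FX <-]] [->|[Y FY <-]]; first by left.
    - by left; exact: subsetUl.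
    - by right; exact: subsetUl.
    - by have [XY|YX] := totF _ _ FX FY; [left|right]; exact: setUS.
  have rG : G `<=` @right_ideal R.
    by move=> _ [->//|[X FX <-]]; case: (Fbad _ FX).
  rewrite /bad GE; split; first exact: right_ideal_chain_bigcup.
  move=> fgU; have := fgU.
  have [->//|[X FX <-]] := chain_fg_bigcup G0 totG rG fgU.
  by case: (Fbad _ FX).
exists (I `|` A); split=> // J rJ ltAJ; apply: contrapT => nfgJ.
have IJ : I `|` J = J.
  by apply/setUidPr; apply: subset_trans (properW ltAJ); exact: subsetUl.
apply: (maxA J); last by rewrite /bad IJ.
have [AJ nJA] := ltAJ; split; first by apply: subset_trans AJ; exact: subsetUr.
by move=> JA; apply: nJA; apply: (subset_trans JA); exact: subsetUr.
Qed.

(** * Complete primeness of maximal non-finitely generated right ideals *)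

(** If [aP] is contained in [P], [ab] is in [P] and [a], [b] are not, then
    [P + aR] and [(P : a)] both contain [P] strictly, because of [a] and [b]
    respectively, so they are finitely generated and [P] would be too. *)
Lemma maximal_non_fg_completely_prime (R : pzRingType) (P : set R) :
  right_ideal P -> ~ fg_right_ideal P ->
  (forall J, right_ideal J -> P `<` J -> fg_right_ideal J) ->
  completely_prime P.
Proof.
move=> rP nfgP maxP; split=> //.
  split=> // TP; apply: nfgP; suff -> : P = [set: R] by exact: fg_setT.
  exact/seteqP.
move=> a b aPP Pab; apply: contrapT => /not_orP[nPa nPb].
apply: nfgP; apply: (@fg_from_adjoin_colon _ _ a) => //; apply: maxP.
- exact: right_ideal_adjoin.
- by split; [exact: sub_adjoin|move=> /(_ a (mem_adjoin a rP))].
- exact: right_ideal_colon.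
- split; last by move=> /(_ b Pab).
  by move=> x Px; apply: aPP; exists x.
Qed.

(** * The ascending chain condition *)

(** If [I] is not finitely generated, each finite subset [A] of [I] spans less
    than [I], so an element [f A] of [I] outside that span can be added to it;
    iterating gives an ascending chain of right ideals that never stops. *)
Lemma right_noetherian_fg (R : pzRingType) (I : set R) :
  right_noetherian R -> right_ideal I -> fg_right_ideal I.
Proof.
move=> noethR rI; apply: contrapT => nfgI.
have /choice[f fP] (A : set R) : exists x,
    finite_set A -> A `<=` I -> I x /\ ~ right_span A x.
  apply: contrapT => /forallNP nx.
  (* If [A] is infinite or not contained in [I], the claim about [x] holds
     vacuously, for instance at [0]. *)
  have finA : finite_set A by apply: contrapT => nfin; apply: (nx 0).
  have AI : A `<=` I by apply: contrapT => nAI; apply: (nx 0).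
  apply: nfgI; apply: (fg_of_subset_span rI finA AI) => x Ix.
  by apply: contrapT => nAx; apply: (nx x).
pose A n := iter n (fun X => X `|` [set f X]) set0.
have AP n : finite_set (A n) /\ A n `<=` I.
  elim: n => [|n [finA AI]]; first by split; [exact: finite_set0|].
  have [IfA _] := fP _ finA AI.
  split; first by rewrite /A iterS finite_setU; split=> //; exact: finite_set1.
  by rewrite /A iterS subUset; split=> // _ ->.
have [|n|N /(_ N.+1 (leqnSn N)) stopN] := noethR (fun n => right_span (A n)).
- by move=> n; exact: right_ideal_right_span.
- by apply: sub_smallest2r; [exact: right_ideal_right_span|exact: subsetUl].
have [finA AI] := AP N; have [_ ] := fP _ finA AI; apply.
by rewrite -stopN; apply: sub_gen_smallest; right.
Qed.

(** The union of an ascending sequence of right ideals is finitely generated,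
    so it is one of the terms, and the sequence is constant from there on. *)
Lemma fg_right_noetherian (R : pzRingType) :
  (forall I : set R, right_ideal I -> fg_right_ideal I) -> right_noetherian R.
Proof.
move=> allfg I rI incI.
have leI m n : (m <= n)%N -> I m `<=` I n.
  by move=> /subnK <-; elim: (n - m)%N => // k; move/subset_trans; apply.
have G0 : range I !=set0 by exists (I 0%N); exists 0%N.
have totG : total_on (range I) subset.
  move=> _ _ [m _ <-] [n _ <-].
  by have [/leI|/ltnW/leI] := leqP m n; [left|right].
have rG : range I `<=` @right_ideal R by move=> _ [n _ <-].
have [N _ IN] : range I (\bigcup_(X in range I) X).
  by apply: chain_fg_bigcup => //; apply/allfg/right_ideal_chain_bigcup.
exists N => n leNn; apply/seteqP; split; last exact: leI.
by rewrite IN => x Ix; exists (I n) => //; exists n.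
Qed.

Theorem theorem3p8 (R : pzRingType) :
  right_noetherian R <->
  (forall P : set R, completely_prime P -> fg_right_ideal P).
Proof.
split=> [noethR P [rP _ _]|cpfg]; first exact: right_noetherian_fg.
apply: fg_right_noetherian => I rI; apply: contrapT => nfgI.
have [P [rP nfgP maxP]] := exists_maximal_non_fg rI nfgI.
exact/nfgP/cpfg/maximal_non_fg_completely_prime.
Qed.
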